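(* Let $r\ge 1$, let $a_1,\dots,a_r,b_1,\dots,b_r$ be positive integers and let $q\in\mathbb{C}$ with $|q|<1$. Then for all $n\ge 0$, $$2E_{n,q}(x\mid a_1,\dots,a_{r-1};b_1,\dots,b_{r-1})=q^{b_r}E_{n,q}(x+a_r\mid a_1,\dots,a_r;b_1,\dots,b_r)+E_{n,q}(x\mid a_1,\dots,a_r;b_1,\dots,b_r).$$
   Context: For positive integers $a_1,\dots,a_s,b_1,\dots,b_s$, the multivariate $q$-Euler polynomials $E_{n,q}(x\mid a_1,\dots,a_s;b_1,\dots,b_s)$ are defined by the generating function $$\sum_{n=0}^{\infty}E_{n,q}(x\mid a_1,\dots,a_s;b_1,\dots,b_s)\frac{t^n}{n!}=\frac{2^s}{(q^{b_1}e^{a_1t}+1)\cdots(q^{b_s}e^{a_st}+1)}e^{xt}.$$ For $s=0$ (which occurs on the left-hand side when $r=1$) the product is empty, so the generating function is $e^{xt}$ and the polynomial is $x^n$. *)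

(* Defs.v *)
From HB Require Import structures.
From mathcomp Require Import all_boot all_order all_algebra.
From mathcomp Require Import boolp functions reals.
From mathcomp Require Import complex.

Set Implicit Arguments.
Unset Strict Implicit.
Unset Printing Implicit Defensive.

Import Order.TTheory GRing.Theory Num.Theory.
Local Open Scope ring_scope.

(* A formal power series \sum_n f_n t^n is represented by n |-> f_n.  The alias
   keeps the Cauchy product apart from the pointwise product that the library
   puts on nat -> A; the additive structure is the pointwise one. *)
Definition fps (A : Type) : Type := nat -> A.

HB.instance Definition _ (A : zmodType) := GRing.Zmodule.copy (fps A) (nat -> A).

Section Ring.
Variable A : comNzRingType.
Implicit Types f g h : fps A.

Definition fpsC (c : A) : fps A := fun n => if n is 0 then c else 0.

Definition fps_mul f g : fps A := fun n => \sum_(i < n.+1) f i * g (n - i)%N.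

Let trunc N f : {poly A} := \poly_(i < N) f i.

Let coef_trunc_mul N f g n :
  (n < N)%N -> (trunc N f * trunc N g)`_n = fps_mul f g n.
Proof.
move=> ltnN; rewrite coefM; apply: eq_bigr => i _; rewrite !coef_poly.
by rewrite !(leq_ltn_trans _ ltnN) ?leq_subr // -ltnS.
Qed.

Let fps_mulC : commutative fps_mul.
Proof. by move=> f g; apply/funext => n; rewrite -!(@coef_trunc_mul n.+1) // mulrC. Qed.

Let fps_mulA : associative fps_mul.
Proof.
move=> f g h; apply/funext => n.
pose N := n.+1; transitivity (trunc N f * (trunc N g * trunc N h))`_n.
  rewrite coefM; apply: eq_bigr => i _.
  by rewrite coef_poly ltn_ord coef_trunc_mul // ltnS leq_subr.
rewrite mulrA coefM; apply: eq_bigr => i _.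
by rewrite coef_trunc_mul // coef_poly ltnS leq_subr.
Qed.

Let fps_mul1 : left_id (fpsC 1) fps_mul.
Proof.
move=> f; apply/funext => n; rewrite /fps_mul big_ord_recl mul1r subn0.
by rewrite big1 ?addr0 // => i _; rewrite mul0r.
Qed.

Let fps_mulDl : left_distributive fps_mul +%R.
Proof.
move=> f g h; apply/funext => n; rewrite /fps_mul -[RHS]big_split.
by apply: eq_bigr => i _; exact: mulrDl.
Qed.

Let fps_1neq0 : fpsC 1 != 0.
Proof. by apply/eqP => /(congr1 (@^~ 0%N))/eqP; rewrite oner_eq0. Qed.

HB.instance Definition _ := GRing.Zmodule_isComNzRing.Build (fps A)
  fps_mulA fps_mulC fps_mul1 fps_mulDl fps_1neq0.

End Ring.

Section UnitRing.
Variable A : comUnitRingType.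
Implicit Types f g : fps A.

(* The first n coefficients g_0, g_1, ... of 1 / f, from the recursion
   f_0 g_m = [m = 0] - \sum_(i < m) g_i f_(m - i). *)
Fixpoint fps_inv_seq f n : seq A :=
  if n is m.+1 then
    let s := fps_inv_seq f m in
    rcons s ((f 0%N)^-1 * ((m == 0%N)%:R - \sum_(i < m) s`_i * f (m - i)%N))
  else [::].

Definition fps_unit : {pred fps A} := fun f => f 0%N \is a GRing.unit.

Definition fps_inv f : fps A :=
  if f \in fps_unit then fun n => (fps_inv_seq f n.+1)`_n else f.

Let size_inv_seq f n : size (fps_inv_seq f n) = n.
Proof. by elim: n => //= n IHn; rewrite size_rcons IHn. Qed.

Let nth_inv_seq f n m : (m < n)%N ->
  (fps_inv_seq f n)`_m = (fps_inv_seq f m.+1)`_m.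
Proof.
elim: n => // n IHn; rewrite ltnS leq_eqVlt => /predU1P[-> //|ltmn].
by rewrite -IHn // [LHS]nth_rcons size_inv_seq ltmn.
Qed.

Let fps_mulVf : {in fps_unit, left_inverse 1 fps_inv *%R}.
Proof.
move=> f Uf; apply/funext => n.
transitivity (fps_mul (fps_inv f) f n) => //.
rewrite /fps_mul /fps_inv Uf big_ord_recr subnn.
rewrite (eq_bigr (fun i : 'I_n => (fps_inv_seq f n)`_i * f (n - i)%N)); last first.
  by move=> i _; rewrite (@nth_inv_seq f n).
rewrite [fps_inv_seq f n.+1]/= nth_rcons size_inv_seq ltnn eqxx.
rewrite -(mulrA (f 0%N)^-1) [_ * f 0%N]mulrC mulKr //= addrC subrK.
by case: n.
Qed.

Let fps_unitPl f g : g * f = 1 -> fps_unit f.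
Proof.
move=> /(congr1 (@^~ 0%N)) gf1; apply/unitrPr; exists (g 0%N).
by rewrite mulrC -[RHS]gf1; apply/esym/big_ord1.
Qed.

Let fps_inv_out : {in [predC fps_unit], fps_inv =1 id}.
Proof. by move=> f /negbTE nUf; rewrite /fps_inv nUf. Qed.

HB.instance Definition _ := GRing.ComNzRing_hasMulInverse.Build (fps A)
  fps_mulVf fps_unitPl fps_inv_out.

(* e^{c t} *)
Definition fps_exp (c : A) : fps A := fun n => c ^+ n / n`!%:R.

End UnitRing.

(* E_{n,q}(x | a_1..a_s; b_1..b_s) as a polynomial in x: n! times the
   coefficient of t^n in the generating function, computed in {poly F}[[t]]
   with 'X for x.  The denominator has constant term \prod_i (q ^ b_i + 1), so
   the quotient is a genuine one as soon as q ^ b_i != -1 for all i. *)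
Definition qEuler (F : numFieldType) (q : F) (s : nat) (a b : 'I_s -> nat)
    (n : nat) : {poly F} :=
  n`!%:R *
  (2 ^+ s / \prod_(i < s) (fpsC ((q ^+ b i)%:P) * fps_exp (a i)%:R + 1)
   * fps_exp 'X : fps {poly F}) n.

(* Main.v *)
Require Import Defs.
From HB Require Import structures.
From mathcomp Require Import all_boot all_order all_algebra.
From mathcomp Require Import boolp reals.
From mathcomp Require Import complex.

Import Order.TTheory GRing.Theory Num.Theory.
Local Open Scope ring_scope.
Local Open Scope complex_scope.

(** The polynomials with r and with r + 1 parameters have generating functions
    G_r and G_(r+1), where G_(r+1) is 2 G_r divided by q^b e^(a t) + 1, for a
    and b the last parameters.  Multiplying back,
      2 G_r(x) = q^b e^(a t) G_(r+1)(x) + G_(r+1)(x),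
    and since x occurs in G_(r+1)(x) only through the factor e^(x t), the
    product e^(a t) G_(r+1)(x) is G_(r+1)(x + a).  The theorem compares the
    coefficients of t^n.

    The division is legitimate because the constant term q^b + 1 of the factor
    is nonzero: |q^b| < 1 ([expr_add1_neq0]).

    The generating function lives in F[x][[t]].  Evaluation at a point is a ring
    morphism F[x] -> F, so it acts coefficientwise as a ring morphism
    F[x][[t]] -> F[[t]] ([map_fps]), which commutes with quotients by units.
    Hence the values of the polynomials at x and at x + a are both read off
    series over F ([horner_qEuler]), and e^((x + a) t) = e^(x t) e^(a t)
    ([fps_expD]) is all that remains of the shift. *)

Definition map_fps {A B : Type} (f : A -> B) (u : fps A) : fps B :=
  fun n => f (u n).

Section MapFps.
Variables (A B : comNzRingType) (f : {rmorphism A -> B}).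

Fact map_fps_is_zmod_morphism : zmod_morphism (map_fps f : fps A -> fps B).
Proof. by move=> u v; apply/funext => n; rewrite /map_fps [LHS]rmorphB. Qed.

Fact map_fps_is_monoid_morphism : monoid_morphism (map_fps f : fps A -> fps B).
Proof.
split=> [|u v]; apply/funext => [[|n]]; rewrite /map_fps /=.
- exact: rmorph1.
- exact: rmorph0.
- by rewrite [LHS]rmorph_sum; apply: eq_bigr => i _; rewrite rmorphM.
- by rewrite [LHS]rmorph_sum; apply: eq_bigr => i _; rewrite rmorphM.
Qed.

HB.instance Definition _ :=
  GRing.isZmodMorphism.Build (fps A) (fps B) (map_fps f)
    map_fps_is_zmod_morphism.
HB.instance Definition _ :=
  GRing.isMonoidMorphism.Build (fps A) (fps B) (map_fps f)
    map_fps_is_monoid_morphism.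

Lemma map_fpsC c : map_fps f (fpsC c) = fpsC (f c).
Proof. by apply/funext => [[|n]] //; exact: rmorph0. Qed.

End MapFps.

(** The factorials have to be units of A because f is only known to commute
    with inverses of units. *)
Lemma map_fps_exp (A B : comUnitRingType) (f : {rmorphism A -> B}) (c : A) :
  (forall n, n`!%:R \is a @GRing.unit A) ->
  map_fps f (fps_exp c) = fps_exp (f c).
Proof.
move=> Ufact; apply/funext => n.
by rewrite /map_fps /fps_exp rmorphM rmorphXn rmorphV ?Ufact // rmorph_nat.
Qed.

Lemma coef_fpsCM (A : comNzRingType) (c : A) (u : fps A) n :
  (fpsC c * u) n = c * u n.
Proof.
rewrite [LHS]big_ord_recl subn0 big1 ?addr0 // => i _.
exact: mul0r.
Qed.

Definition qEuler_factor {A : comUnitRingType} (c : A) (m : nat) : fps A :=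
  fpsC c * fps_exp m%:R + 1.

(** The constant term of the factor is c + 1, whatever m is. *)
Lemma qEuler_factor_unit {A : comUnitRingType} (c : A) m :
  (qEuler_factor c m \is a GRing.unit) = (c + 1 \is a GRing.unit).
Proof.
have -> : (qEuler_factor c m \is a GRing.unit) =
  (qEuler_factor c m 0%N \is a GRing.unit) by [].
congr (_ \is a _).
rewrite -[LHS]/((fpsC c * fps_exp m%:R) 0%N + (1 : A)).
by rewrite coef_fpsCM /fps_exp expr0 divr1 mulr1.
Qed.

Section NumField.
Variable F : numFieldType.
Implicit Types (q c d x : F) (n : nat).

Lemma fact_neq0 n : n`!%:R != 0 :> F.
Proof. by rewrite pnatr_eq0 -lt0n fact_gt0. Qed.

(** This is the binomial theorem: C(n, i) / n! = 1 / (i! (n - i)!). *)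
Lemma fps_expD c d : fps_exp (c + d) = fps_exp c * fps_exp d.
Proof.
apply/funext => n; rewrite /fps_exp addrC exprDn mulr_suml.
apply: eq_bigr => i _; have lein : (i <= n)%N by rewrite -ltnS.
have := congr1 (fun m => m%:R : F) (bin_fact lein); rewrite !natrM => <-.
have bin_neq0 : 'C(n, i)%:R != 0 :> F by rewrite pnatr_eq0 -lt0n bin_gt0.
rewrite -mulr_natr !invfM !mulrA mulfK //.
by rewrite [c ^+ i / _ * _]mulrAC [c ^+ i * _]mulrC.
Qed.

Lemma expr_add1_neq0 q n : (0 < n)%N -> `|q| < 1 -> q ^+ n + 1 != 0.
Proof.
move=> n_gt0 q_lt1; rewrite addr_eq0; apply/eqP => qn.
have := exprn_ilt1 n (normr_ge0 q) q_lt1.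
by rewrite lt0n_neq0 // -normrX qn normrN1 ltxx.
Qed.

(** Evaluation at x is applied to the whole series before any coefficient is
    computed; it passes through the inverse because the denominator is a unit
    of F[x][[t]], its constant term being a nonzero constant. *)
Lemma horner_qEuler q s (a b : 'I_s -> nat) n x :
  (forall i, q ^+ b i + 1 != 0) ->
  (qEuler q a b n).[x] =
  n`!%:R * (2 ^+ s / \prod_(i < s) qEuler_factor (q ^+ b i) (a i)
            * fps_exp x) n.
Proof.
move=> qb_neq0.
have Ufact m : m`!%:R \is a @GRing.unit {poly F}.
  by rewrite -polyC_natr rmorph_unit // unitfE fact_neq0.
have Uden : \prod_(i < s) qEuler_factor (q ^+ b i)%:P (a i) \is a GRing.unit.
  apply: rpred_prod => i _; rewrite qEuler_factor_unit -polyCD.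
  by rewrite rmorph_unit // unitfE.
rewrite -/(horner_eval x _) /qEuler rmorphM rmorph_nat.
congr (_ * _).
rewrite -[LHS]/(map_fps (horner_eval x) _ n); congr (_ n : F).
rewrite !rmorphM rmorphV // rmorphXn rmorph_nat rmorph_prod /= map_fps_exp //=.
rewrite [horner_eval x 'X]hornerX; congr (_ / _ * _ : fps F).
apply: eq_bigr => i _; rewrite rmorphD rmorph1 rmorphM /= map_fps_exp //.
by rewrite map_fpsC rmorph_nat /= [horner_eval x _]hornerC.
Qed.

End NumField.

Theorem theorem2 (R : realType) (r : nat) (a b : 'I_r.+1 -> nat) (q : R[i])
    (ha : forall i, (0 < a i)%N) (hb : forall i, (0 < b i)%N)
    (hq : `|q| < 1) (n : nat) (x : R[i]) :
  2 * (qEuler q (fun i : 'I_r => a (widen_ord (leqnSn r) i))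
                (fun i : 'I_r => b (widen_ord (leqnSn r) i)) n).[x] =
  q ^+ b ord_max * (qEuler q a b n).[x + (a ord_max)%:R] + (qEuler q a b n).[x].
Proof.
have qb_neq0 i : q ^+ b i + 1 != 0 by exact: expr_add1_neq0.
rewrite !horner_qEuler //.
rewrite ![_ * (n`!%:R * _)]mulrCA -mulrDr; congr (_ * _).
rewrite fps_expD big_ord_recr exprS /=.
set P := \prod_(i < r) _; set D := qEuler_factor _ _.
have UD : D \is a GRing.unit by rewrite qEuler_factor_unit unitfE.
have UP : P \is a GRing.unit.
  by apply: rpred_prod => i _; rewrite qEuler_factor_unit unitfE.
have fpsC2 : fpsC 2 = 2 :> fps R[i].
  by apply/funext => -[|m] //; rewrite -[LHS](addr0 0).
(* Both scalars become constant series, leaving an identity between series. *)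
rewrite -[LHS]coef_fpsCM fpsC2 -[q ^+ _ * _]coef_fpsCM.
rewrite -[RHS]/((_ + _ : fps R[i]) n); congr (_ n : R[i]).
set E := fps_exp x; set G : fps R[i] := 2 * 2 ^+ r / (P * D).
have -> : fpsC (q ^+ b ord_max) * (G * (E * fps_exp (a ord_max)%:R)) + G * E
          = G * D * E.
  rewrite /D /qEuler_factor mulrDr mulr1 mulrDl; congr (_ + _).
  by rewrite mulrCA -!mulrA [E * _]mulrC.
by rewrite /G invrM // -!mulrA (mulrCA D^-1) mulKr.
Qed.
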